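(* Let $\{z(k)=(x(k),u(k)) : k\ge 0\}$ be an input-state sequence of the control system described in the context, let $\psi:\mathsf{Z}\to\mathbb{R}^d$ be the basis, let $\mathrm{Tol}\ge 0$, and for each $N\ge 1$ let $$\Theta_N=\{\theta\in\mathbb{R}^d:\ \Gamma_N(\theta)\le \mathrm{Tol}\},\qquad \Gamma_N(\theta)=\frac1N\sum_{k=0}^{N-1}\max\{0,-\mathcal{D}^\circ_{k+1}(\theta)\}.$$ Assume that the limits $$\bar\psi=\lim_{N\to\infty}\frac1N\sum_{k=0}^{N-1}\psi(z(k)),\qquad R^\psi=\lim_{N\to\infty}\frac1N\sum_{k=0}^{N-1}\psi(z(k))\psi(z(k))^{\top}$$ exist (in $\mathbb{R}^d$ and $\mathbb{R}^{d\times d}$), and set $\Sigma^\psi=R^\psi-\bar\psi\bar\psi^{\top}$. Then: (i) For every $N\ge 1$ the constraint region $\Theta_N$ is non-empty, since it contains $\theta=0$. (ii) If $\Sigma^\psi$ has full rank, then there exists $N_0\ge 1$ such that $\Theta_N$ is bounded for all $N\ge N_0$.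
   Context: Setting. The state space $\mathsf{X}$ is a closed subset of $\mathbb{R}^n$, and the input space $\mathsf{U}$ is a finite set. For each $x\in\mathsf{X}$ there is a non-empty set $\mathsf{U}(x)\subset\mathsf{U}$ of admissible inputs, and $\mathsf{Z}=\{(x,u): x\in\mathsf{X},\,u\in\mathsf{U}(x)\}$. The dynamics are $x(k+1)=\mathrm{F}(x(k),u(k))$, $k\ge0$, with $\mathrm{F}:\mathsf{X}\times\mathsf{U}\to\mathsf{X}$ and $u(k)\in\mathsf{U}(x(k))$ for each $k$; write $z(k)=(x(k),u(k))\in\mathsf{Z}$. There is an equilibrium pair $z^e=(x^e,u^e)\in\mathsf{Z}$ with $x^e=\mathrm{F}(x^e,u^e)$. The cost function $c:\mathsf{Z}\to[0,\infty)$ satisfies $c(z^e)=0$. Function class. $\psi=(\psi_1,\dots,\psi_d):\mathsf{Z}\to\mathbb{R}^d$ with $\psi_i(z^e)=0$ for each $i$, and $Q^\theta(z)=\theta^{\top}\psi(z)$ for $\theta\in\mathbb{R}^d$, $z\in\mathsf{Z}$. For a function $Q$ on $\mathsf{Z}$, $\underline{Q}(x)=\min_{u\in\mathsf{U}(x)}Q(x,u)$. Temporal difference: $\mathcal{D}^\circ_{k+1}(\theta)=-Q^\theta(z(k))+c(z(k))+\underline{Q}^\theta(x(k+1))$. *)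

(* Defs.v *)
From HB Require Import structures.
From mathcomp Require Import all_boot all_order all_algebra.
From mathcomp Require Import all_classical all_reals all_analysis.

Set Implicit Arguments.
Unset Strict Implicit.
Unset Printing Implicit Defensive.

Import Order.TTheory GRing.Theory Num.Theory.
Import numFieldNormedType.Exports.
Local Open Scope classical_set_scope.
Local Open Scope ring_scope.

(* The maps are total; the hypotheses constrain [dyn] only on X x U and
   [cost] only on the admissible pairs, so the values elsewhere are junk. *)
Record control_system (R : realType) (n : nat) (U : finType) := ControlSystem {
  state : set 'cV[R]_n;
  adm : 'cV[R]_n -> {set U};
  dyn : 'cV[R]_n -> U -> 'cV[R]_n;
  cost : 'cV[R]_n * U -> R;
  xeq : 'cV[R]_n;
  ueq : U;
  state_closed : closed state;
  adm_nonempty : forall x, state x -> adm x != finset.set0;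
  dyn_state : forall x u, state x -> state (dyn x u);
  xeq_state : state xeq;
  ueq_adm : ueq \in adm xeq;
  dyn_eq : dyn xeq ueq = xeq;
  cost_ge0 : forall x u, state x -> u \in adm x -> 0 <= cost (x, u);
  cost_eq : cost (xeq, ueq) = 0
}.

Section ControlSystem.
Variables (R : realType) (n : nat) (U : finType) (S : control_system R n U).

Definition zeq : 'cV[R]_n * U := (xeq S, ueq S).

Definition input_state_sequence (z : nat -> 'cV[R]_n * U) : Prop :=
  state S (z 0%N).1 /\
  forall k : nat, (z k).2 \in adm S (z k).1 /\
                  (z k.+1).1 = dyn S (z k).1 (z k).2.

(* The value 0 is only taken when [adm S x] is empty, hence never on X. *)
Definition qmin (Q : 'cV[R]_n * U -> R) (x : 'cV[R]_n) : R :=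
  if [pick u in adm S x] is Some u0
  then Q (x, [arg min_(u < u0 in adm S x) Q (x, u)]%O) else 0.

Lemma qminP (Q : 'cV[R]_n * U -> R) (x : 'cV[R]_n) : state S x ->
  (exists2 u, u \in adm S x & qmin Q x = Q (x, u)) /\
  (forall u, u \in adm S x -> qmin Q x <= Q (x, u)).
Proof.
move=> /adm_nonempty /finset.set0Pn [u1 u1P]; rewrite /qmin.
case: pickP => [u0 u0P|/(_ u1)]; last by rewrite u1P.
by case: arg_minP => // u uP umin; split=> //; exists u.
Qed.

Variables (d : nat) (psi : 'cV[R]_n * U -> 'cV[R]_d).

Definition Qfun (theta : 'cV[R]_d) (z : 'cV[R]_n * U) : R :=
  (theta^T *m psi z) 0 0.

(* [tdiff z k theta] is the temporal difference with index k + 1. *)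
Definition tdiff (z : nat -> 'cV[R]_n * U) (k : nat) (theta : 'cV[R]_d) : R :=
  - Qfun theta (z k) + cost S (z k) + qmin (Qfun theta) (z k.+1).1.

Definition Gam (z : nat -> 'cV[R]_n * U) (N : nat) (theta : 'cV[R]_d) : R :=
  N%:R^-1 * \sum_(k < N) Num.max 0 (- tdiff z k theta).

Definition Theta (z : nat -> 'cV[R]_n * U) (Tol : R) (N : nat) :
  set 'cV[R]_d := [set theta | Gam z N theta <= Tol].

Definition psi_mean (z : nat -> 'cV[R]_n * U) (N : nat) : 'cV[R]_d :=
  N%:R^-1 *: \sum_(k < N) psi (z k).

Definition psi_corr (z : nat -> 'cV[R]_n * U) (N : nat) : 'M[R]_d :=
  N%:R^-1 *: \sum_(k < N) (psi (z k) *m (psi (z k))^T).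

End ControlSystem.

(* Main.v *)
(* On an admissible trajectory, theta in Theta_N forces
     Q^theta(z(k)) - Q^theta(z(k+1)) <= N Tol + c(z(k))   for k < N,
   because the minimum defining the temporal difference is at most
   Q^theta(z(k+1)).  A direction theta in which none of these finitely many
   linear forms is positive makes theta . psi(z(k)) nondecreasing in k; if this
   held for all k, convergence of the time averages would make
   theta . psi(z(k)) converge, so its empirical variance would tend to 0, that
   is theta^T Sigma theta = 0, and theta = 0 since Sigma is symmetric, positive
   semidefinite and nonsingular.  By compactness of the unit sphere, finitely
   many k already exclude every unit theta with a uniform margin; this fixes
   N_0 and bounds Theta_N for N >= N_0. *)

Require Import Defs.
From mathcomp Require Import all_boot all_order all_algebra.
From mathcomp Require Import all_classical all_reals all_analysis.
From mathcomp Require Import finmap zify ring lra.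
Import Order.TTheory GRing.Theory Num.Theory.
Import numFieldNormedType.Exports.
Local Open Scope classical_set_scope.
Local Open Scope ring_scope.

(** * Cesàro means of real sequences *)

(** Values in any module, so that [psi_mean] and [psi_corr] are both instances by conversion. *)
Definition cesaro_mean {R : numFieldType} {V : lmodType R} (u : nat -> V)
  (N : nat) : V := N%:R^-1 *: \sum_(k < N) u k.

Lemma cvg_cesaro_mean {R : realType} {u : R ^nat} {l : R} :
  u @ \oo --> l -> (cesaro_mean u : R ^nat) @ \oo --> l.
Proof.
(* [arithmetic_mean] at [n] averages [n + 1] terms, hence the shift. *)
move=> /cesaro ul; rewrite -cvg_shiftS; apply: cvg_trans ul; apply: near_eq_cvg.
by apply: nearW => n /=; rewrite /arithmetic_mean /series /= big_mkord.
Qed.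

Lemma ler_natl_sum (R : realType) (N : nat) (x : R) (u : 'I_N -> R) :
  (forall k, x <= u k) -> N%:R * x <= \sum_(k < N) u k.
Proof.
move=> xu; rewrite mulr_natl -[in leLHS](card_ord N) -sumr_const.
by apply: ler_sum => k _; exact: xu.
Qed.

(* The last [N] of the first [2N] terms are at least [u N]: a convergent mean
   therefore bounds [u]. *)
Lemma cvg_nondecreasing_cesaro {R : realType} {u : R ^nat} {m : R} :
  nondecreasing_seq u -> (cesaro_mean u : R ^nat) @ \oo --> m -> u @ \oo --> m.
Proof.
move=> ndu um; have [M] : has_ubound (range (cesaro_mean u : R ^nat)).
  by apply/bounded_fun_has_ubound/cvg_seq_bounded/cvg_ex; exists m.
move=> uM.
have ubu : has_ubound (range u).
  (* The first half of the terms is at least [u 0], whence [u 0 + u N.+1 <= 2 * M]; the entry [u 0]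
     covers index 0. *)
  exists (Num.max (u 0%N) (2 * M - u 0%N)) => _ [N _ <-].
  case: N => [|N]; rewrite le_max; first by rewrite lexx.
  apply/orP; right.
  have := uM _ (imageT (cesaro_mean u : R ^nat) (N.+1 + N.+1)%N).
  rewrite /cesaro_mean big_split_ord /= /GRing.scale /=.
  rewrite ler_pdivrMl ?ltr0n// => h.
  have h1 : N.+1%:R * u 0%N <= \sum_(k < N.+1) u k.
    by apply: ler_natl_sum => k; exact: ndu.
  have h2 : N.+1%:R * u N.+1 <= \sum_(k < N.+1) u (N.+1 + k)%N.
    by apply: ler_natl_sum => k; apply: ndu; exact: leq_addr.
  have h3 : N.+1%:R * (u 0%N + u N.+1) <= N.+1%:R * (2 * M).
    rewrite mulrDr; apply: le_trans (lerD h1 h2) _; apply: le_trans h _.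
    by rewrite natrD; lra.
  by rewrite ler_pM2l ?ltr0n// in h3; lra.
have ul : u @ \oo --> limn u by exact: nondecreasing_is_cvgn.
suff -> : m = limn u by [].
exact: (cvg_unique _ um (cvg_cesaro_mean ul)).
Qed.

(** * Bilinear forms of matrices *)

Lemma cvg_mxform {R : realType} {m n : nat} {T : Type} {F : set_system T}
    {FF : Filter F} {A : T -> 'M[R]_(m, n)} {B : 'M[R]_(m, n)}
    (u : 'rV[R]_m) (v : 'cV[R]_n) :
  A x @[x --> F] --> B ->
  (u *m A x *m v) 0 0 @[x --> F] --> (u *m B *m v) 0 0.
Proof.
move=> AB.
have formE M : (u *m M *m v) 0 0 = \sum_j (\sum_i u 0 i * M i j) * v j 0.
  by rewrite mxE; apply: eq_bigr => j _; rewrite mxE.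
rewrite formE; under eq_cvg do rewrite formE.
apply: cvg_big => [|j _]; first exact: add_continuous.
apply: cvgMr_tmp.
apply: cvg_big => [|i _]; first exact: add_continuous.
apply: cvgMl_tmp.
by apply: (@cvg_comp _ _ _ A (fun M : 'M[R]_(m, n) => M i j) _ _ _ AB);
  exact: coord_continuous.
Qed.

Lemma continuous_row_mulmx (R : realType) (n : nat) (v : 'cV[R]_n) :
  continuous (fun w : 'rV[R]_n => (w *m v) 0 0).
Proof.
have -> : (fun w => (w *m v) 0 0) =
    (fun w : 'rV[R]_n => (1%:M *m w *m v) 0 0 : R).
  by rewrite funeqE => w; rewrite mul1mx.
move=> w.
exact: (@cvg_mxform _ _ _ _ (nbhs w) _ (fun x => x) w 1%:M v cvg_id).
Qed.

Lemma mx_norm_trmx (R : realType) (m n : nat) (A : 'M[R]_(m, n)) :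
  `|A^T| = `|A|.
Proof.
rewrite /Num.Def.normr /= !mx_normrE.
rewrite (reindex (fun ij : 'I_m * 'I_n => (ij.2, ij.1))) /=; last first.
  by exists (fun ji => (ji.2, ji.1)) => -[].
by apply: eq_bigr => -[i j] _ /=; rewrite mxE.
Qed.

Lemma mx11D (R : realType) (A B : 'M[R]_1) : (A + B) 0 0 = A 0 0 + B 0 0.
Proof. by rewrite mxE. Qed.

Lemma mx11Z (R : realType) (a : R) (A : 'M[R]_1) : (a *: A) 0 0 = a * A 0 0.
Proof. by rewrite mxE. Qed.

(* Positivity at [v + t w] is a quadratic inequality in [t] without constant
   term, so its linear coefficient vanishes. *)
Lemma psd_mulmx_eq0 {R : realType} {d : nat} {A : 'M[R]_d} {v : 'cV[R]_d} :
  A^T = A -> (forall w : 'cV[R]_d, 0 <= (w^T *m A *m w) 0 0) ->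
  (v^T *m A *m v) 0 0 = 0 -> A *m v = 0.
Proof.
move=> symA psdA v0.
have form0 (w : 'cV[R]_d) : (w^T *m A *m v) 0 0 = 0.
  set b : R := (w^T *m A *m v) 0 0; set a : R := (w^T *m A *m w) 0 0.
  have vAw : (v^T *m A *m w) 0 0 = b.
    rewrite /b -[in RHS](trmxK (w^T *m A *m v)) [in RHS]mxE.
    by rewrite !trmx_mul trmxK symA mulmxA.
  have quad t : 0 <= t * (2 * b + t * a).
    have := psdA (v + t *: w).
    rewrite !(linearD, linearZ) /= !(mulmxDl, mulmxDr).
    rewrite -!scalemxAl !(mx11D, mx11Z) v0 vAw -/a -/b.
    by rewrite (_ : 0 + _ + _ = t * (2 * b + t * a)) //; ring.
  have a0 : 0 <= a by exact: psdA.
  apply/eqP/negP => /negP b0.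
  have a1 : 0 < a + 1 by rewrite ltr_wpDl.
  (* Near the minimiser [- b / a]; the shift by 1 allows [a = 0], and the value is negative unless
     [b = 0]. *)
  have := quad (- b / (a + 1)).
  have -> : - b / (a + 1) * (2 * b + - b / (a + 1) * a) =
    - (b / (a + 1)) ^+ 2 * (a + 2).
    by field; rewrite gt_eqF.
  rewrite mulNr oppr_ge0 leNgt mulr_gt0// ?exprn_even_gt0//=; last lra.
  by rewrite mulf_neq0// invr_eq0 gt_eqF.
apply/matrixP => i j; rewrite ord1 [RHS]mxE.
have := form0 (delta_mx i 0).
by rewrite -mulmxA trmx_delta -rowE mxE.
Qed.

(** * The limiting covariance *)

Section TimeAverages.
Context {R : realType} {d : nat} {f : nat -> 'cV[R]_d}.
Context {b : 'cV[R]_d} {C : 'M[R]_d}.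
Hypothesis fb : cesaro_mean f N @[N --> \oo] --> b.
Hypothesis fC :
  cesaro_mean (fun k => f k *m (f k)^T) N @[N --> \oo] --> C.

Lemma cvg_cesaro_row (w : 'rV[R]_d) :
  (cesaro_mean (fun k => (w *m f k) 0 0) : R ^nat) @ \oo --> (w *m b) 0 0.
Proof.
rewrite -[w *m b]mulmx1; apply: cvg_trans; last exact: (cvg_mxform w 1%:M fb).
apply: near_eq_cvg; apply: nearW => N.
by rewrite mulmx1 /cesaro_mean -scalemxAr mulmx_sumr mx11Z summxE.
Qed.

Lemma cvg_cesaro_row_sqr (w : 'rV[R]_d) :
  (cesaro_mean (fun k => (w *m f k) 0 0 ^+ 2) : R ^nat) @ \oo -->
  (w *m C *m w^T) 0 0.
Proof.
apply: cvg_trans; last exact: (cvg_mxform w w^T fC).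
apply: near_eq_cvg; apply: nearW => N.
rewrite /cesaro_mean -scalemxAr -scalemxAl mulmx_sumr mulmx_suml mx11Z summxE.
congr (_ * _); apply: eq_bigr => k _.
rewrite mulmxA -(mulmxA (w *m f k)) -trmx_mul mxE big_ord1.
by rewrite [X in _ * X]mxE expr2.
Qed.

Let Sigma := C - b *m b^T.

(** Each empirical correlation matrix is symmetric, and entrywise limits are unique. *)
Lemma trmx_cov : Sigma^T = Sigma.
Proof.
suff CT : C^T = C by rewrite /Sigma linearB /= trmx_mul trmxK CT.
apply/matrixP => i j; rewrite mxE.
have fCij i' j' : cesaro_mean (fun k => f k *m (f k)^T) N i' j' @[N --> \oo]
    --> C i' j'.
  apply: (@cvg_comp _ _ _ _ (fun M : 'M[R]_d => M i' j') _ _ _ fC).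
  exact: coord_continuous.
have corrC N : cesaro_mean (fun k => f k *m (f k)^T) N i j =
    cesaro_mean (fun k => f k *m (f k)^T) N j i.
  rewrite !mxE; congr (_ * _); rewrite !summxE; apply: eq_bigr => k _.
  by rewrite !mxE; apply: eq_bigr => l _; rewrite !mxE mulrC.
have fCji : cesaro_mean (fun k => f k *m (f k)^T) N i j @[N --> \oo] --> C j i.
  by under eq_cvg do rewrite corrC; exact: fCij.
exact: (cvg_unique _ fCji (fCij i j)).
Qed.

Lemma cov_form (w : 'rV[R]_d) :
  (w *m Sigma *m w^T) 0 0 = (w *m C *m w^T) 0 0 - (w *m b) 0 0 ^+ 2.
Proof.
rewrite /Sigma mulmxBr mulmxBl mxE; congr (_ + _); rewrite mxE; congr (- _).
rewrite mulmxA -(mulmxA (w *m b)) -trmx_mul mxE big_ord1.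
by rewrite [X in _ * X]mxE expr2.
Qed.

(** Averaging [(x - m) ^+ 2 >= 0] over the samples [x] of [w *m f k] bounds the mean of
    [x ^+ 2 - 2 * m * x] below by [- m ^+ 2]; this passes to the limit. *)
Lemma cov_psd (w : 'rV[R]_d) : 0 <= (w *m Sigma *m w^T) 0 0.
Proof.
rewrite cov_form; set m : R := (w *m b) 0 0.
have : (cesaro_mean (fun k => (w *m f k) 0 0 ^+ 2) N : R) -
    2 * m * cesaro_mean (fun k => (w *m f k) 0 0) N @[N --> \oo] -->
    (w *m C *m w^T) 0 0 - 2 * m * m.
  apply: cvgB; first exact: cvg_cesaro_row_sqr.
  by apply: cvgMl_tmp; exact: cvg_cesaro_row.
move=> h.
suff : - m ^+ 2 <= (w *m C *m w^T) 0 0 - 2 * m * m by nra.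
apply: (cvgr_to_ge h); apply: nearW => -[|N];
  rewrite /cesaro_mean /GRing.scale /=.
  by rewrite !big_ord0 !mulr0 subr0 oppr_le0 sqr_ge0.
rewrite mulrCA -mulrBr ler_pdivlMl ?ltr0n// mulr_sumr -sumrB.
apply: ler_natl_sum => k; rewrite -subr_ge0.
by rewrite (_ : _ - _ = ((w *m f k) 0 0 - m) ^+ 2) ?sqr_ge0//; ring.
Qed.

Lemma nondecreasing_row_eq0 {w : 'rV[R]_d} : \rank Sigma = d ->
  nondecreasing_seq (fun k => (w *m f k) 0 0) -> w = 0.
Proof.
move=> rkS ndw.
have wfm := cvg_nondecreasing_cesaro ndw (cvg_cesaro_row w).
have wf2 : (cesaro_mean (fun k => (w *m f k) 0 0 ^+ 2) : R ^nat) @ \oo -->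
  (w *m b) 0 0 ^+ 2 by exact: cvg_cesaro_mean (cvgM wfm wfm).
have form0 : (w *m Sigma *m w^T) 0 0 = 0.
  rewrite cov_form; apply/eqP; rewrite subr_eq0; apply/eqP.
  exact: (cvg_unique _ (cvg_cesaro_row_sqr w) wf2).
have /(congr1 (mulmx (invmx Sigma))) : Sigma *m w^T = 0.
  apply: psd_mulmx_eq0 => [|v|]; first exact: trmx_cov.
    by have := cov_psd v^T; rewrite trmxK.
  by rewrite trmxK.
rewrite mulKmx; last by rewrite -row_full_unit /row_full rkS.
by rewrite mulmx0 => /(congr1 trmx); rewrite trmxK trmx0.
Qed.

End TimeAverages.

(** * Compactness of the unit sphere *)

(** One [N] serves both as the number of forms and as the inverse of the margin; homogeneity extends
    the bound from the sphere to all nonzero [w]. *)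
Lemma trivial_cone_bound (R : realType) (d : nat) (g : nat -> 'cV[R]_d) :
  (forall w : 'rV[R]_d, (forall k, (w *m g k) 0 0 <= 0) -> w = 0) ->
  exists N : nat, forall w : 'rV[R]_d, w != 0 ->
    exists2 k, (k < N)%N & `|w| < N%:R * (w *m g k) 0 0.
Proof.
move=> g0.
(* The sets [V N] increase with [N], so a finite subcover of the sphere is a
   single one of them. *)
pose V (N : nat) := \bigcup_(k in [set k | (k < N)%N])
  [set w : 'rV[R]_d | 1 < N%:R * (w *m g k) 0 0].
have openV N : [set: nat] N -> open (V N).
  move=> _; apply: bigcup_open => k _.
  apply: (@open_comp _ _ (fun w : 'rV[R]_d => N%:R * (w *m g k) 0 0)
    [set x | 1 < x]); last exact: open_gt.
  by move=> w _; exact: (@cvgMl_tmp _ _ (nbhs w) _ _ _ _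
    (continuous_row_mulmx _ _ (g k) w)).
have subV M N : (M <= N)%N -> V M `<=` V N.
  move=> MN w [k /= kM h]; exists k; first exact: leq_trans MN.
  apply: (lt_le_trans h) => /=; rewrite ler_wpM2r ?ler_nat//.
  (* Enlarging the factor needs the form to be nonnegative, which [1 < M * form] gives. *)
  have M0 : 0 < M%:R :> R by rewrite ltr0n; case: (M) kM.
  by rewrite -(pmulr_rge0 _ M0) (le_trans ler01) ?ltW.
pose sphere := [set w : 'rV[R]_d | `|w| = 1].
have compact_sphere : compact sphere.
  apply: bounded_closed_compact.
    exists 1; split; first exact: num_real.
    by move=> M M1 w /= ->; exact: ltW.
  apply: (@closed_comp _ _ (fun w : 'rV[R]_d => `|w|) [set 1]).
    by move=> w _; exact: norm_continuous.
  exact: closed_eq.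
have coverV : sphere `<=` cover [set: nat] V.
  move=> w w1; have [k gk] : exists k, 0 < (w *m g k) 0 0.
    apply/not_existsP => h; have w0 : w = 0.
      by apply: g0 => k; rewrite leNgt; apply/negP; exact: h.
    by move: w1; rewrite /sphere /= w0 normr0 => /eqP; rewrite eq_sym oner_eq0.
  (* The first entry admits the index [k], the second lifts the product above 1. *)
  exists (maxn k.+1 (Num.bound ((w *m g k) 0 0)^-1)) => //.
  exists k => /=; first by rewrite leq_max leqnn.
  rewrite -ltr_pdivrMr// mul1r.
  apply: lt_le_trans (archi_boundP _) _; first by rewrite invr_ge0 ltW.
  by rewrite ler_nat leq_max leqnn orbT.
move: compact_sphere; rewrite compact_cover => /(_ _ _ _ openV coverV).
move=> [D _ DV]; exists (\max_(i <- D) i) => w w0.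
have nw : 0 < `|w| by rewrite normr_gt0.
have /DV [i Di Vi] : sphere (`|w|^-1 *: w).
  by rewrite /sphere /= normrZ normfV normr_id mulVf// gt_eqF.
have [|k /= kN] := subV i (\max_(j <- D) j)%N _ _ Vi.
  by apply: leq_bigmax_seq.
rewrite -scalemxAl mx11Z mulrCA -ltr_pdivrMl ?invr_gt0// invrK mulr1 => h.
by exists k.
Qed.

(** * Trajectories and the constraint region *)

Lemma state_seq {R : realType} {n : nat} {U : finType}
    {S : control_system R n U} {z : nat -> 'cV[R]_n * U} (k : nat) :
  input_state_sequence S z -> state S (z k).1.
Proof.
move=> [z0 zS]; elim: k => // k IH.
by have [_ ->] := zS k; exact: dyn_state.
Qed.

Lemma Theta_Qfun_le {R : realType} {n d : nat} {U : finType}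
    {S : control_system R n U} {psi : 'cV[R]_n * U -> 'cV[R]_d}
    {z : nat -> 'cV[R]_n * U} {Tol : R} {N k : nat} {theta : 'cV[R]_d} :
  input_state_sequence S z -> Theta S psi z Tol N theta -> (k < N)%N ->
  Qfun psi theta (z k) - Qfun psi theta (z k.+1) <=
    N%:R * Tol + cost S (z k).
Proof.
move=> hz; rewrite /Theta /= /Gam => GT kN.
have N0 : 0 < N%:R :> R by rewrite ltr0n; case: (N) kN.
rewrite ler_pdivrMl// (bigD1 (Ordinal kN)) //= in GT.
(* All summands are nonnegative, so each one is at most the whole sum. *)
have maxk : - tdiff S psi z k theta <= N%:R * Tol.
  apply: le_trans GT; rewrite -[leLHS]addr0; apply: lerD.
    by rewrite le_max lexx orbT.
  by apply: sumr_ge0 => i _; rewrite le_max lexx.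
have [_ /(_ (z k.+1).2)] := qminP (Qfun psi theta) (state_seq k.+1 hz).
have [zadm _] := hz.2 k.+1.
rewrite -surjective_pairing => /(_ zadm).
by move: maxk; rewrite /tdiff; lra.
Qed.

Theorem theorem2p2 (R : realType) (n d : nat) (U : finType)
  (S : control_system R n U)
  (psi : 'cV[R]_n * U -> 'cV[R]_d)
  (psi_eq : forall i : 'I_d, psi (zeq S) i 0 = 0)
  (z : nat -> 'cV[R]_n * U)
  (hz : input_state_sequence S z)
  (Tol : R) (Tol_ge0 : 0 <= Tol)
  (psibar : 'cV[R]_d) (Rpsi : 'M[R]_d)
  (hpsibar : psi_mean psi z N @[N --> \oo] --> psibar)
  (hRpsi : psi_corr psi z N @[N --> \oo] --> Rpsi) :
  (forall N : nat, (1 <= N)%N ->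
     Theta S psi z Tol N !=set0 /\ Theta S psi z Tol N 0) /\
  (\rank (Rpsi - psibar *m psibar^T) = d ->
   exists2 N0 : nat, (1 <= N0)%N &
     forall N : nat, (N0 <= N)%N -> bounded_set (Theta S psi z Tol N)).
Proof.
have sz k := state_seq k hz.
have cost0 k : 0 <= cost S (z k).
  by rewrite [z k]surjective_pairing; apply: cost_ge0; [|have [] := hz.2 k].
have Theta0 N : Theta S psi z Tol N 0.
  have Q0 y : Qfun psi 0 y = 0 by rewrite /Qfun trmx0 mul0mx mxE.
  have q0 x : qmin S (Qfun psi 0) x = 0 by rewrite /qmin; case: pickP.
  (* At [theta = 0] the temporal difference is the cost, so every positive part vanishes. *)
  rewrite /Theta /= /Gam big1 ?mulr0// => k _.
  by rewrite /tdiff Q0 q0 oppr0 add0r addr0; apply/max_idPl; rewrite oppr_le0.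
split=> [N _|rkS]; first by split=> //; exists 0.
have [|N0 hN0] := @trivial_cone_bound R d (fun k => psi (z k) - psi (z k.+1)).
  move=> w hw.
  apply: (@nondecreasing_row_eq0 _ _ (psi \o z) _ _ hpsibar hRpsi _ rkS).
  apply/nondecreasing_seqP => k; have := hw k.
  by rewrite mulmxBr mxE [in X in _ + X]mxE subr_le0.
exists N0.+1 => // N N0N.
(* The sum dominates each single cost, making the bound uniform in [k < N0]; it may depend on
   [N]. *)
pose M := N0%:R * (N%:R * Tol + \sum_(k < N0) cost S (z k)).
have M0 : 0 <= M by rewrite mulr_ge0 ?addr_ge0 ?mulr_ge0 ?sumr_ge0.
exists M; split; first exact: num_real.
move=> M' MM' theta hT /=; apply: le_trans (ltW MM').
have [->|t0] := eqVneq theta 0; first by rewrite normr0.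
have [|k kN0] := hN0 theta^T; first by rewrite trmx_eq0.
rewrite mx_norm_trmx => /ltW /le_trans; apply.
rewrite ler_wpM2l// mulmxBr mxE [in X in _ + X]mxE.
have kN : (k < N)%N by lia.
apply: le_trans (Theta_Qfun_le hz hT kN) _.
rewrite lerD2l (bigD1 (Ordinal kN0)) //=.
by rewrite lerDl sumr_ge0.
Qed.
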